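(* Let $a\in\mathbb{R}$ with $|a|<1$. For $k\in\mathbb{N}$ and $x\in\mathbb{R}$ let $c_k(x)=\sqrt2\cos(2k\pi x)$, $s_k(x)=\sqrt2\sin(2k\pi x)$, and define $$\widehat c_k(x)=\sqrt{1-a^2}\sum_{n=0}^\infty a^n c_k(2^nx),\qquad \widehat s_k(x)=\sqrt{1-a^2}\sum_{n=0}^\infty a^n s_k(2^nx).$$ For $i\in\mathbb{N}$ define $$\widetilde c_i=\begin{cases}\widehat c_i & i \text{ odd},\\ \dfrac{\widehat c_i-a\widehat c_{i/2}}{\sqrt{1-a^2}}=\sqrt{1-a^2}\,\widehat c_i-a\,c_{i/2} & i \text{ even},\end{cases}\qquad \widetilde s_i=\begin{cases}\widehat s_i & i \text{ odd},\\ \dfrac{\widehat s_i-a\widehat s_{i/2}}{\sqrt{1-a^2}}=\sqrt{1-a^2}\,\widehat s_i-a\,s_{i/2} & i \text{ even}.\end{cases}$$ Then $\{1,\widetilde c_k,\widetilde s_k:k\in\mathbb{N}\}$ is a complete orthonormal basis of $L^2([0,1])$ (and the two displayed expressions for the even case agree).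
   Context: $L^2([0,1])$ has inner product $\langle f,h\rangle=\int_0^1 f(x)h(x)\,dx$. The functions $\widehat c_k,\widehat s_k$ equal $\sqrt{1-a^2}\,M_{a,2}^{-1}c_k$ and $\sqrt{1-a^2}\,M_{a,2}^{-1}s_k$, where $(M_{a,2}f)(x)=f(x)-af(2x)$. *)

(* Defs.v *)
From HB Require Import structures.
From mathcomp Require Import all_boot all_order all_algebra.
From mathcomp Require Import all_classical all_reals all_analysis.
Set Implicit Arguments. Unset Strict Implicit. Unset Printing Implicit Defensive.
Import Order.TTheory GRing.Theory Num.Theory.
Import numFieldNormedType.Exports.
Local Open Scope classical_set_scope.
Local Open Scope ring_scope.

Section Defs.
Variable R : realType.

Definition I01 : set R := `[0%R, 1%R].

Definition ck (k : nat) (x : R) : R := Num.sqrt 2 * cos (2 * k%:R * pi * x).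
Definition sk (k : nat) (x : R) : R := Num.sqrt 2 * sin (2 * k%:R * pi * x).

Definition hat (a : R) (f : R -> R) (x : R) : R :=
  Num.sqrt (1 - a ^+ 2) * limn (series (fun n => a ^+ n * f (2 ^+ n * x))).

Definition chat (a : R) (k : nat) : R -> R := hat a (ck k).
Definition shat (a : R) (k : nat) : R -> R := hat a (sk k).

Definition tildeF (a : R) (h : nat -> R -> R) (i : nat) (x : R) : R :=
  if odd i then h i x
  else (h i x - a * h i./2 x) / Num.sqrt (1 - a ^+ 2).

Definition ctilde (a : R) (i : nat) : R -> R := tildeF a (chat a) i.
Definition stilde (a : R) (i : nat) : R -> R := tildeF a (shat a) i.

Definition sysF (a : R) (j : option (bool * nat)) : R -> R :=
  match j with
  | None => fun _ => 1
  | Some (true, n) => ctilde a n.+1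
  | Some (false, n) => stilde a n.+1
  end.

Definition orthonormal_L2_01 (I : eqType) (e : I -> R -> R) : Prop :=
  forall i j : I,
    (lebesgue_measure : measure _ R).-integrable I01
         (fun x => (e i x * e j x)%:E) /\
    (\int[lebesgue_measure]_(x in I01) (e i x * e j x)%:E
       = ((i == j)%:R)%:E)%E.

Definition complete_L2_01 (I : eqType) (e : I -> R -> R) : Prop :=
  forall f : R -> R,
    measurable_fun I01 f ->
    (\int[lebesgue_measure]_(x in I01) ((f x) ^+ 2)%:E < +oo)%E ->
    forall eps : R, 0 < eps ->
      exists (s : seq I) (alpha : I -> R),
        (\int[lebesgue_measure]_(x in I01)
           ((f x - \sum_(i <- s) alpha i * e i x) ^+ 2)%:E < eps%:E)%E.

End Defs.

(* Main.v *)
(** The recurrence hat_k = sqrt(1 - a^2) f_k + a hat_(2k), where f_k is c_k or s_k,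
    drives both halves.

    Orthonormality: iterating it N times leaves a remainder O(a^N), which gives
    <hat_i, f_l> = 0 for l < i and <hat_i, hat_j> = [i = j] for K <= i, j < 2K.  Hence
    the f_l (l < K) and hat_l (K <= l < 2K) form an orthonormal family.  The
    recurrence and tilde_(2k) = sqrt(1 - a^2) hat_(2k) - a f_k say that
    (hat_k, tilde_(2k)) is a rotation of (f_k, hat_(2k)), so applying these rotations
    for k = K - 1, ..., 1 turns that family into the tilde_l (l < 2K).

    Completeness: every hat_k, hence every f_k, is a finite combination of the
    tilde_l, so it suffices that trigonometric polynomials are dense in L^2.  For a
    trigonometric polynomial u with values in [0, 1], the trigonometric polynomials
    (1 - u^n)^(2^n) converge boundedly to the indicator of {u < 1/2} off {u = 1/2};
    a suitable u of degree 1 yields the indicator of any interval [0, q[.  Measurable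
    sets follow by the pi-lambda theorem, and L^2 by monotone approximation. *)

Require Import Defs.
From HB Require Import structures.
From mathcomp Require Import all_boot all_order all_algebra.
From mathcomp Require Import all_classical all_reals all_analysis measurable_realfun.
From mathcomp Require Import ring lra.
Import Order.TTheory GRing.Theory Num.Theory.
Import numFieldNormedType.Exports.
Local Open Scope classical_set_scope.
Local Open Scope ring_scope.

Set Implicit Arguments.
Unset Strict Implicit.

(** * Bounded measurable functions and the inner product on [0, 1] *)

Definition bdd_measurable {R : realType} (f : R -> R) : Prop :=
  measurable_fun setT f /\ exists C : R, forall x, `|f x| <= C.

(** The integral here is real-valued, with value 0 when the extended integral is infinite.
    Bilinearity is therefore proved on [bdd_measurable] functions, whose products are all integrable
    on [0, 1]. *)
Definition ip01 {R : realType} (f g : R -> R) : R :=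
  \int[@lebesgue_measure R]_(x in @I01 R) (f x * g x).

Section BoundedMeasurable.
Context {R : realType}.
Implicit Types (f g h : R -> R) (r s : R).
Local Notation mu := (@lebesgue_measure R).
Local Notation I := (@I01 R).

Lemma measurable_I01 : measurable I.
Proof. exact: measurable_itv. Qed.

Lemma mu_I01 : mu I = 1%:E.
Proof. by rewrite lebesgue_measure_itv /= lte_fin ltr01 -EFinD subr0. Qed.

Lemma bdd_measurable_cst r : bdd_measurable (fun=> r).
Proof. by split => //; exists `|r|. Qed.

Lemma bdd_measurableD f g : bdd_measurable f -> bdd_measurable g ->
  bdd_measurable (fun x => f x + g x).
Proof.
move=> [mf [C fC]] [mg [D gD]]; split; first exact: measurable_funD.
by exists (C + D) => x; rewrite (le_trans (ler_normD _ _))// lerD.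
Qed.

Lemma bdd_measurableM f g : bdd_measurable f -> bdd_measurable g ->
  bdd_measurable (fun x => f x * g x).
Proof.
move=> [mf [C fC]] [mg [D gD]]; split; first exact: measurable_funM.
by exists (C * D) => x; rewrite normrM ler_pM.
Qed.

Lemma bdd_measurableZ r f : bdd_measurable f -> bdd_measurable (fun x => r * f x).
Proof. exact/bdd_measurableM/bdd_measurable_cst. Qed.

Lemma bdd_measurable_comp f r : bdd_measurable f ->
  bdd_measurable (fun x => f (r * x)).
Proof.
move=> [mf [C fC]]; split; last by exists C => x.
by apply: (measurableT_comp mf); exact: mulrl_measurable.
Qed.

Lemma bdd_measurable_cos : bdd_measurable (@cos R).
Proof.
split; first by apply: continuous_measurable_fun; exact: continuous_cos.
by exists 1 => x; exact: cos_max.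
Qed.

Lemma bdd_measurable_sin : bdd_measurable (@sin R).
Proof.
split; first by apply: continuous_measurable_fun; exact: continuous_sin.
by exists 1 => x; exact: sin_max.
Qed.

Lemma bdd_measurable_integrable f : bdd_measurable f ->
  mu.-integrable I (EFin \o f).
Proof.
move=> [mf [C fC]]; apply: measurable_bounded_integrable.
- exact: measurable_I01.
- by rewrite [X in (X < _)%E]mu_I01 ltry.
- exact: measurable_funTS.
- exists C; split => [|M CM x _ /=]; first by rewrite num_real.
  exact: le_trans (fC x) (ltW CM).
Qed.

Lemma ip01C f g : ip01 f g = ip01 g f.
Proof. by apply: eq_Rintegral => x _; rewrite mulrC. Qed.

Lemma ip01_lin r s f g h :
  bdd_measurable f -> bdd_measurable g -> bdd_measurable h ->
  ip01 (fun x => r * f x + s * g x) h = r * ip01 f h + s * ip01 g h.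
Proof.
move=> bf bg bh; rewrite /ip01.
have E (t : R) (k : R -> R) : bdd_measurable k ->
    t * (\int[mu]_(x in I) (k x * h x)) = \int[mu]_(x in I) (t * (k x * h x)).
  move=> bk; rewrite RintegralZl//; first exact: measurable_I01.
  exact/bdd_measurable_integrable/bdd_measurableM.
rewrite !E// -RintegralD.
- by apply: eq_Rintegral => x _; rewrite mulrDl !mulrA.
- exact: measurable_I01.
- exact/bdd_measurable_integrable/bdd_measurableZ/bdd_measurableM.
- exact/bdd_measurable_integrable/bdd_measurableZ/bdd_measurableM.
Qed.

Lemma ip01_bilin r s r' s' f g f' g' :
  bdd_measurable f -> bdd_measurable g ->
  bdd_measurable f' -> bdd_measurable g' ->
  ip01 (fun x => r * f x + s * g x) (fun x => r' * f' x + s' * g' x) =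
  r * r' * ip01 f f' + r * s' * ip01 f g' + s * r' * ip01 g f' + s * s' * ip01 g g'.
Proof.
move=> bf bg bf' bg'; rewrite ip01_lin//; last first.
  by apply: bdd_measurableD; exact: bdd_measurableZ.
rewrite (ip01C f) (ip01C g) !ip01_lin// (ip01C f' f) (ip01C g' f) (ip01C f' g) (ip01C g' g).
by rewrite !mulrDr !mulrA !addrA.
Qed.

Lemma ip01_bound f g (C D : R) : bdd_measurable f -> bdd_measurable g ->
  (forall x, `|f x| <= C) -> (forall x, `|g x| <= D) -> `|ip01 f g| <= C * D.
Proof.
move=> bf bg fC gD; have bfg := bdd_measurableM bf bg.
have ifg := bdd_measurable_integrable bfg.
apply: le_trans (le_normr_Rintegral _ ifg) _; first exact: measurable_I01.
have <- : \int[mu]_(x in I) (C * D) = C * D.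
  rewrite Rintegral_cst; last exact: measurable_I01.
  by rewrite [X in fine X]mu_I01 mulr1.
apply: le_Rintegral.
- exact: measurable_I01.
- exact: integrable_norm.
- exact/bdd_measurable_integrable/bdd_measurable_cst.
- by move=> x _; rewrite normrM ler_pM.
Qed.

End BoundedMeasurable.

(** * Orthonormality of the cosines ([true]) and sines ([false]) *)

Definition trig {R : realType} (b : bool) : nat -> R -> R := if b then @ck R else @sk R.

Section TrigOrthonormal.
Context {R : realType}.
Implicit Types (r x : R) (i j k : nat).
Local Notation mu := (@lebesgue_measure R).
Local Notation I := (@I01 R).

Lemma Rintegral_I01_FTC (f F : R -> R) :
  (forall x, is_derive x 1 F (f x)) -> continuous f ->
  \int[mu]_(x in I) f x = F 1 - F 0.
Proof.
move=> dF cf; have cF : continuous F.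
  by move=> x; apply/differentiable_continuous/derivable1_diffP; have [] := dF x.
rewrite /Rintegral (@continuous_FTC2 R f F 0 1) ?ltr01//.
- exact: continuous_subspaceT.
- split => [x _| |]; first by have [] := dF x.
  + apply: cvg_at_right_filter; exact: cF.
  + apply: cvg_at_left_filter; exact: cF.
- by move=> x _; rewrite derive1E; have [] := dF x.
Qed.

Let is_derive_scale r x : is_derive x 1 (fun y => r * y) r.
Proof.
have := @is_deriveZ _ _ _ (@id R) r x 1 1 (is_derive_id _ _).
by rewrite /GRing.scale /= mulr1.
Qed.

Lemma Rintegral_I01_cos r : r != 0 ->
  \int[mu]_(x in I) cos (r * x) = sin r / r.
Proof.
move=> r0.
have dF x : is_derive x 1 (fun x => r^-1 * sin (r * x)) (cos (r * x)).
  have h := is_derive1_comp (is_derive_sin (r * x)) (is_derive_scale r x).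
  have := @is_deriveZ _ _ _ _ (r^-1) x 1 _ h.
  by rewrite /GRing.scale /= mulrC mulfK.
rewrite (Rintegral_I01_FTC dF); first by rewrite mulr1 mulr0 sin0 mulr0 subr0 mulrC.
move=> x; apply: (@continuous_comp _ _ _ (fun x => r * x) cos).
  exact: mulrl_continuous.
exact: continuous_cos.
Qed.

Lemma Rintegral_I01_sin r : r != 0 ->
  \int[mu]_(x in I) sin (r * x) = (1 - cos r) / r.
Proof.
move=> r0.
have dF x : is_derive x 1 (fun x => - r^-1 * cos (r * x)) (sin (r * x)).
  have h := is_derive1_comp (is_derive_cos (r * x)) (is_derive_scale r x).
  have := @is_deriveZ _ _ _ _ (- r^-1) x 1 _ h.
  by rewrite /GRing.scale /= !mulNr mulrN opprK mulrC mulfK.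
rewrite (Rintegral_I01_FTC dF).
  by rewrite mulr1 mulr0 cos0 mulr1 mulNr opprK mulrBl mul1r addrC mulrC.
move=> x; apply: (@continuous_comp _ _ _ (fun x => r * x) sin).
  exact: mulrl_continuous.
exact: continuous_sin.
Qed.

Lemma cos_sin_2pi k : cos (2 * k%:R * pi : R) = 1 /\ sin (2 * k%:R * pi : R) = 0.
Proof.
elim: k => [|k [IHc IHs]]; first by rewrite mulr0 mul0r cos0 sin0.
have -> : 2 * k.+1%:R * pi = 2 * k%:R * pi + pi *+ 2 :> R by rewrite -natr1; ring.
by rewrite cosD2pi sinD2pi.
Qed.

Let rateB i j : (2 * i%:R * pi - 2 * j%:R * pi != 0 :> R) = (i != j).
Proof.
rewrite subr_eq0; congr (~~ _); apply/eqP/eqP => [|->//].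
move/(mulIf (lt0r_neq0 (pi_gt0 R)))/(mulfI (_ : (2 != 0 :> R))).
by move=> h; apply/eqP; rewrite -(eqr_nat R); apply/eqP/h.
Qed.

Let rateD i j : (0 < i)%N -> 2 * i%:R * pi + 2 * j%:R * pi != 0 :> R.
Proof.
move=> i0; apply: lt0r_neq0; rewrite ltr_wpDr ?mulr_ge0 ?pi_ge0//.
by rewrite !mulr_gt0 ?pi_gt0 ?ltr0n.
Qed.

Let intcosB i j :
  \int[mu]_(x in I) cos ((2 * i%:R * pi - 2 * j%:R * pi) * x) = (i == j)%:R.
Proof.
have [->|ij] := eqVneq i j.
  under eq_Rintegral do rewrite subrr mul0r cos0.
  rewrite Rintegral_cst; last exact: measurable_I01.
  by rewrite [X in fine X]mu_I01 mulr1.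
rewrite Rintegral_I01_cos ?rateB// sinB.
have [-> ->] := cos_sin_2pi i; have [-> ->] := cos_sin_2pi j.
by rewrite mul0r mulr0 subrr mul0r.
Qed.

Let intcosD i j : (0 < i)%N ->
  \int[mu]_(x in I) cos ((2 * i%:R * pi + 2 * j%:R * pi) * x) = 0.
Proof.
move=> i0; rewrite Rintegral_I01_cos ?rateD// sinD.
have [-> ->] := cos_sin_2pi i; have [-> ->] := cos_sin_2pi j.
by rewrite mul0r mulr0 addr0 mul0r.
Qed.

Let intsinB i j :
  \int[mu]_(x in I) sin ((2 * i%:R * pi - 2 * j%:R * pi) * x) = 0.
Proof.
have [->|ij] := eqVneq i j.
  under eq_Rintegral do rewrite subrr mul0r sin0.
  by rewrite Rintegral_cst ?mul0r//; exact: measurable_I01.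
rewrite Rintegral_I01_sin ?rateB// cosB.
have [-> ->] := cos_sin_2pi i; have [-> ->] := cos_sin_2pi j.
by rewrite mulr0 addr0 mulr1 subrr mul0r.
Qed.

Let intsinD i j : (0 < i)%N ->
  \int[mu]_(x in I) sin ((2 * i%:R * pi + 2 * j%:R * pi) * x) = 0.
Proof.
move=> i0; rewrite Rintegral_I01_sin ?rateD// cosD.
have [-> ->] := cos_sin_2pi i; have [-> ->] := cos_sin_2pi j.
by rewrite mulr0 subr0 mulr1 subrr mul0r.
Qed.

Let sqrt2M x y : Num.sqrt 2 * x * (Num.sqrt 2 * y) = 2 * (x * y) :> R.
Proof. by rewrite mulrACA -expr2 sqr_sqrtr. Qed.

(** Product-to-sum: the two factors [Num.sqrt 2] cancel the usual 1/2. This formula and the next two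
    give the inner products below, and later the closure of trigonometric polynomials under
    products. *)
Lemma ckM i j x : ck i x * ck j x =
  cos ((2 * i%:R * pi - 2 * j%:R * pi) * x) + cos ((2 * i%:R * pi + 2 * j%:R * pi) * x).
Proof. by rewrite sqrt2M mulrBl (mulrDl _ _ x) cosB (cosD (2 * i%:R * pi * x)); ring. Qed.

Lemma skM i j x : sk i x * sk j x =
  cos ((2 * i%:R * pi - 2 * j%:R * pi) * x) - cos ((2 * i%:R * pi + 2 * j%:R * pi) * x).
Proof. by rewrite sqrt2M mulrBl (mulrDl _ _ x) cosB (cosD (2 * i%:R * pi * x)); ring. Qed.

Lemma sk_ckM i j x : sk i x * ck j x =
  sin ((2 * i%:R * pi - 2 * j%:R * pi) * x) + sin ((2 * i%:R * pi + 2 * j%:R * pi) * x).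
Proof. by rewrite sqrt2M mulrBl (mulrDl _ _ x) sinB (sinD (2 * i%:R * pi * x)); ring. Qed.

Let intcos r : mu.-integrable I (EFin \o (fun x => cos (r * x))).
Proof. exact/bdd_measurable_integrable/bdd_measurable_comp/bdd_measurable_cos. Qed.

Let intsin r : mu.-integrable I (EFin \o (fun x => sin (r * x))).
Proof. exact/bdd_measurable_integrable/bdd_measurable_comp/bdd_measurable_sin. Qed.

Lemma bdd_measurable_trig b k : bdd_measurable (@trig R b k).
Proof.
case: b; apply: bdd_measurableZ; apply: bdd_measurable_comp.
- exact: bdd_measurable_cos.
- exact: bdd_measurable_sin.
Qed.

Lemma ip01_trig b c i j : (0 < i)%N -> (0 < j)%N ->
  ip01 (@trig R b i) (trig c j) = ((b == c) && (i == j))%:R.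
Proof.
move=> i0 j0; have mI := @measurable_I01 R.
(* The swap puts the sine first in the mixed case, as [sk_ckM] requires. In the cosine-cosine case
   it exchanges the indices, hence the later [eq_sym]. *)
case: b; case: c; rewrite /trig ?[ip01 (ck i) _]ip01C /ip01 /=.
- under eq_Rintegral do rewrite ckM.
  by rewrite RintegralD// intcosB intcosD// addr0 eq_sym.
- under eq_Rintegral do rewrite sk_ckM.
  by rewrite RintegralD// intsinB intsinD// addr0.
- under eq_Rintegral do rewrite sk_ckM.
  by rewrite RintegralD// intsinB intsinD// addr0.
- under eq_Rintegral do rewrite skM.
  by rewrite RintegralB// intcosB intcosD// subr0.
Qed.

Lemma ip01_trig_cst b i : (0 < i)%N -> ip01 (@trig R b i) (fun=> 1) = 0.
Proof.
move=> i0; have mI := @measurable_I01 R.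
rewrite /ip01; under eq_Rintegral do rewrite mulr1.
(* The constant has frequency 0, so [rateD] is taken at [j = 0]. *)
have r0 : 2 * i%:R * pi != 0 :> R by have := @rateD i 0 i0; rewrite mulr0 mul0r addr0.
case: b => /=; rewrite /ck /sk RintegralZl// ?Rintegral_I01_cos ?Rintegral_I01_sin//;
  have [ci si] := cos_sin_2pi i.
  by rewrite si mul0r mulr0.
by rewrite ci subrr mul0r mulr0.
Qed.

End TrigOrthonormal.

(** * The hat series and its recurrence *)

Section HatSeries.
Context {R : realType}.
Variable a : R.
Hypothesis ha : `|a| < 1.
Implicit Types (f : R -> R) (x : R) (b c : bool) (i j k l : nat).
Local Notation sq := (Num.sqrt (1 - a ^+ 2)).

Lemma onem_sqr_gt0 : 0 < 1 - a ^+ 2.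
Proof. by rewrite subr_gt0 -real_normK ?num_real// expr_lt1. Qed.

Let sq2 : sq * sq = 1 - a ^+ 2.
Proof. by rewrite -expr2 sqr_sqrtr// ltW// onem_sqr_gt0. Qed.

Lemma sqrt_onem_sqr_neq0 : sq != 0.
Proof. by rewrite sqrtr_eq0 -ltNge onem_sqr_gt0. Qed.

(** Closes every remainder argument: a quantity that each use of the recurrence shrinks by a factor
    of at most |a| is bounded by |a|^N C for all N, and this tends to 0. *)
Lemma eq0_of_decay (v C : R) : (forall N, `|v| <= `|a| ^+ N * C) -> v = 0.
Proof.
move=> vC; apply/eqP; rewrite -normr_le0.
have : (fun N : nat => geometric C `|a| N) @ \oo --> (0 : R).
  by apply: cvg_geometric; rewrite normr_id.
move=> h; rewrite -(cvg_lim _ h)//; apply: limr_ge; first by apply/cvg_ex; exists 0.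
by apply: nearW => N /=; rewrite mulrC.
Qed.

Section Hat.
Variables (f : R -> R) (C : R).
Hypothesis fC : forall x, `|f x| <= C.

Let C0 : 0 <= C. Proof. exact: le_trans (fC 0). Qed.

Let term_le x n : `|a ^+ n * f (2 ^+ n * x)| <= geometric C `|a| n.
Proof. by rewrite /= normrM normrX mulrC ler_wpM2r// exprn_ge0. Qed.

Let normed_hat_cvg x : cvgn [normed series (fun n => a ^+ n * f (2 ^+ n * x))].
Proof.
apply: series_le_cvg (term_le x) _ => [//|n|]; first by rewrite /= mulr_ge0// exprn_ge0.
by apply: is_cvg_geometric_series; rewrite normr_id.
Qed.

Lemma hat_cvg x : cvgn (series (fun n => a ^+ n * f (2 ^+ n * x))).
Proof. exact: normed_cvg (@normed_hat_cvg x). Qed.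

Lemma hat_bound x : `|hat a f x| <= sq * (C / (1 - `|a|)).
Proof.
rewrite /hat normrM ger0_norm ?sqrtr_ge0// ler_wpM2l ?sqrtr_ge0//.
apply: le_trans (lim_series_norm (@normed_hat_cvg x)) _.
have ha' : `| `|a| | < 1 by rewrite normr_id.
rewrite -(cvg_lim _ (cvg_geometric_series (a := C) ha'))//.
apply: lim_series_le; [exact: normed_hat_cvg| |exact: term_le].
exact: is_cvg_geometric_series.
Qed.

(** Splitting off the term n = 0 and factoring out one [a] leaves the same series at the point 2x.
    On partial sums this is a shift of the index by one. *)
Lemma hat_rec x : hat a f x = sq * f x + a * hat a f (2 * x).
Proof.
rewrite /hat [a * _]mulrCA -mulrDr; congr (_ * _).
apply/cvg_lim => //; rewrite -cvg_shiftS.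
rewrite (_ : (fun n => _) = (fun n => f x +
    a * series (fun n => a ^+ n * f (2 ^+ n * (2 * x))) n)).
  apply: cvgD; first exact: cvg_cst.
  by apply: cvgM; [exact: cvg_cst|exact: hat_cvg].
apply/funext => n; rewrite /series /= big_nat_recl//= !expr0 !mul1r; congr (_ + _).
by rewrite mulr_sumr; apply: eq_bigr => k _; rewrite exprS -mulrA exprSr !mulrA.
Qed.

Lemma bdd_measurable_hat : measurable_fun setT f -> bdd_measurable (hat a f).
Proof.
move=> mf; split; last by exists (sq * (C / (1 - `|a|))) => x; exact: hat_bound.
apply: measurable_funM => //.
apply: (@measurable_fun_cvg _ _ _ setT
  (fun n x => series (fun n => a ^+ n * f (2 ^+ n * x)) n)) => [n|x _].
  rewrite /series /=; apply: measurable_sum => k.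
  apply: measurable_funM => //.
  by apply: (measurableT_comp mf); exact: mulrl_measurable.
exact: hat_cvg.
Qed.

End Hat.

Definition hat_trig b k : R -> R := hat a (@trig R b k).
Definition tilde_trig b : nat -> R -> R := tildeF a (hat_trig b).

Let trig_bound b k x : `|@trig R b k x| <= Num.sqrt 2.
Proof.
have s2 : `|Num.sqrt 2 : R| = Num.sqrt 2 by rewrite ger0_norm// sqrtr_ge0.
by case: b; rewrite /trig /ck /sk normrM s2 ler_piMr ?sqrtr_ge0 ?cos_max ?sin_max.
Qed.

(** The constant is uniform in [k] because the recurrence doubles the index at each iteration. *)
Lemma hat_trig_bound : exists2 C, 0 <= C & forall b k x, `|hat_trig b k x| <= C.
Proof.
exists (sq * (Num.sqrt 2 / (1 - `|a|))).
  by rewrite mulr_ge0 ?sqrtr_ge0// divr_ge0 ?sqrtr_ge0// subr_ge0 ltW.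
by move=> b k x; apply: hat_bound => y; exact: trig_bound.
Qed.

Lemma bdd_measurable_hat_trig b k : bdd_measurable (hat_trig b k).
Proof.
by apply: bdd_measurable_hat (trig_bound b k) _; have [] := @bdd_measurable_trig R b k.
Qed.

Lemma trig_double b k x : trig b k (2 * x) = trig b k.*2 x.
Proof.
have E : 2 * k%:R * pi * (2 * x) = 2 * k.*2%:R * pi * x :> R.
  by rewrite -mul2n natrM; ring.
by case: b; rewrite /trig /ck /sk E.
Qed.

Lemma hat_trig_rec b k x :
  hat_trig b k x = sq * trig b k x + a * hat_trig b k.*2 x.
Proof.
rewrite {1}/hat_trig (hat_rec (trig_bound b k)); congr (_ + a * (_ * _)).
by congr (limn (series _)); apply/funext => n; rewrite mulrCA trig_double.
Qed.

(** Eliminating hat_k by the recurrence leaves hat_(2k) with coefficient (1 - a^2) / sq = sq. This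
    is the agreement of the two even-case formulas, and the second row of the rotation used
    below. *)
Lemma tilde_trig_double b k x :
  tilde_trig b k.*2 x = sq * hat_trig b k.*2 x - a * trig b k x.
Proof.
rewrite /tilde_trig /tildeF odd_double doubleK (hat_trig_rec b k).
apply: (mulIf sqrt_onem_sqr_neq0); rewrite divfK ?sqrt_onem_sqr_neq0//.
by rewrite mulrBl mulrAC sq2; ring.
Qed.

Lemma tilde_trig_odd b k : odd k -> tilde_trig b k = hat_trig b k.
Proof. by move=> ok; apply/funext => x; rewrite /tilde_trig /tildeF ok. Qed.

Lemma bdd_measurable_tilde_trig b k : bdd_measurable (tilde_trig b k).
Proof.
have [ok|ek] := boolP (odd k).
  by rewrite tilde_trig_odd//; exact: bdd_measurable_hat_trig.
rewrite -(even_halfK ek).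
have -> : tilde_trig b k./2.*2 =
    (fun x => sq * hat_trig b k./2.*2 x + - a * trig b k./2 x).
  by apply/funext => x; rewrite tilde_trig_double mulNr.
apply: bdd_measurableD; apply: bdd_measurableZ.
  exact: bdd_measurable_hat_trig.
exact: bdd_measurable_trig.
Qed.

End HatSeries.

(** * Orthonormality of the tilde system *)

Section Gram.
Context {R : realType}.
Variable a : R.
Hypothesis ha : `|a| < 1.
Implicit Types (x : R) (b c : bool) (i j k l M : nat).
Local Notation sq := (Num.sqrt (1 - a ^+ 2)).
Local Notation H := (hat_trig a).
Local Notation T := (@trig R).

Let sq2 : sq * sq = 1 - a ^+ 2.
Proof. by rewrite -expr2 sqr_sqrtr// ltW// onem_sqr_gt0. Qed.

Let bT b k : bdd_measurable (T b k). Proof. exact: bdd_measurable_trig. Qed.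
Let bH b k : bdd_measurable (H b k). Proof. exact: bdd_measurable_hat_trig. Qed.
Let btilde b k : bdd_measurable (tilde_trig a b k).
Proof. exact: bdd_measurable_tilde_trig. Qed.

Let HE b k : H b k = (fun x => sq * T b k x + a * H b k.*2 x).
Proof. by apply/funext => x; exact: hat_trig_rec. Qed.

Let bound_ip (C D : R) b i (g : R -> R) :
  (forall b k x, `|H b k x| <= C) -> bdd_measurable g ->
  (forall x, `|g x| <= D) -> `|ip01 (H b i) g| <= C * D.
Proof. by move=> HC bg gD; apply: ip01_bound. Qed.

(** Only f_i, f_(2i), f_(4i), ... occur in hat_i, and each is orthogonal to f_l when the types
    differ or l < i. Each induction step removes one of these terms and doubles [i], which preserves
    the hypothesis. *)
Lemma ip01_hat_trig0 b c i l : (0 < i)%N -> (0 < l)%N -> (b != c) || (l < i)%N ->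
  ip01 (H b i) (T c l) = 0.
Proof.
move=> i0 l0 bcil.
have [C C0 HC] := hat_trig_bound ha; have [_ [D TD]] := bT c l.
apply: (@eq0_of_decay R a ha _ (C * D)) => N.
elim: N i i0 bcil => [|N IHN] i i0 bcil; first by rewrite mul1r bound_ip.
rewrite HE ip01_lin// ip01_trig//.
have -> : (b == c) && (i == l) = false.
  by case: eqP bcil => //= _; case: ltngtP.
rewrite mulr0 add0r normrM exprS -mulrA ler_wpM2l// IHN ?double_gt0//.
case/orP: bcil => [->//|li]; apply/orP; right.
by rewrite -addnn (leq_trans li)// leq_addr.
Qed.

(** The defect, inner product minus Kronecker delta, at (i, j) is a^2 times the defect at (2i, 2j):
    the bounds i < 2j and j < 2i kill the cross terms and are stable under doubling. Iteration makes
    the defect vanish. *)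
Lemma ip01_hat_trig b c i j : (0 < i)%N -> (0 < j)%N ->
    (i < j.*2)%N -> (j < i.*2)%N ->
  ip01 (H b i) (H c j) = ((b == c) && (i == j))%:R.
Proof.
move=> i0 j0 ij ji; apply/eqP; rewrite -subr_eq0; apply/eqP.
have [C C0 HC] := hat_trig_bound ha.
apply: (@eq0_of_decay R a ha _ (C * C + 1)) => N.
elim: N i j i0 j0 ij ji => [|N IHN] i j i0 j0 ij ji.
  rewrite mul1r (le_trans (ler_normB _ _))// lerD ?bound_ip//.
  by rewrite ger0_norm// lern1 leq_b1.
have -> : ip01 (H b i) (H c j) - ((b == c) && (i == j))%:R =
  a ^+ 2 * (ip01 (H b i.*2) (H c j.*2) - ((b == c) && (i.*2 == j.*2))%:R).
  rewrite (HE b i) (HE c j) ip01_bilin// ip01_trig//.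
  rewrite (ip01C (T b i)) !ip01_hat_trig0 ?double_gt0 ?ij ?ji ?orbT//.
  rewrite (inj_eq double_inj) sq2; ring.
(* The factor a^2 is weakened to |a|, the rate that [eq0_of_decay] expects. *)
have a2 : `|a| ^+ 2 <= `|a| by rewrite expr2 ler_piMr// ltW.
rewrite normrM normrX; apply: le_trans (ler_wpM2r (normr_ge0 _) a2) _.
rewrite exprS -mulrA ler_wpM2l//.
by apply: IHN; rewrite ?double_gt0 ?ltn_double.
Qed.

(* Lowering [M.+1] to [M] rotates the pair [(T b M, H b M.*2)] into
   [(H b M, tilde_trig a b M.*2)] and changes nothing else, so orthonormality
   propagates downwards, from [M] large to [M = 1]. *)
Definition hybrid M b k : R -> R :=
  if (k < M)%N then T b k else if (k < M.*2)%N then H b k else tilde_trig a b k.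

(** Sparse form of the rotation: row [k] has the entry [rot_diag] in column [k] and [rot_off] in
    column [rot_partner]. Rows other than [M] and [M.*2] are those of the identity. *)
Definition rot_partner M k : nat :=
  if k == M then M.*2 else if k == M.*2 then M else k.

Definition rot_diag M k : R := if (k == M) || (k == M.*2) then sq else 1.

Definition rot_off M k : R := if k == M then a else if k == M.*2 then - a else 0.

Let bhybrid M b k : bdd_measurable (hybrid M b k).
Proof. by rewrite /hybrid; case: ifP => // _; case: ifP. Qed.

Lemma hybrid_rot M b k : (0 < M)%N -> hybrid M b k = (fun x =>
  rot_diag M k * hybrid M.+1 b k x
  + rot_off M k * hybrid M.+1 b (rot_partner M k) x).
Proof.
move=> M0; apply/funext => x; rewrite /rot_diag /rot_off /rot_partner.
have M2 : (M < M.*2)%N by rewrite -addnn -[ltnLHS]addn0 ltn_add2l.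
have [->|kM] := eqVneq k M => /=.
  rewrite /hybrid ltnn M2 ltnSn [(M.*2 < M.+1)%N]ltnNge M2 /= ltn_double ltnSn.
  exact: hat_trig_rec.
have [->|k2M] := eqVneq k M.*2 => /=.
  rewrite /hybrid [(M.*2 < M)%N]ltnNge (ltnW M2) ltnn /= ltnSn.
  rewrite [(M.*2 < M.+1)%N]ltnNge M2 /= ltn_double ltnSn mulNr.
  exact: tilde_trig_double.
rewrite mul1r mul0r addr0 /hybrid ltnS (leq_eqVlt k) (negbTE kM) /=.
have [//|Mk] := ltnP k M.
have [k2|] := ltnP k M.*2; first by rewrite (ltn_trans k2)// ltn_double.
rewrite leq_eqVlt eq_sym (negbTE k2M) /= => k2.
(* Index 2M + 1 also changes branch, but it is odd, so hat and tilde agree there. *)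
rewrite doubleS ltnS leq_eqVlt ltnS leqNgt k2 orbF.
have [->|//] := eqVneq k M.*2.+1.
by rewrite tilde_trig_odd//= odd_double.
Qed.

(** Induction on [K - M] with [K] fixed. At M = K the family consists of f_l for l < K and hat_l for
    K <= l < 2K, whose inner products are known. Each step down is a rotation. *)
Lemma ip01_hybrid M K b c i j : (0 < M <= K)%N ->
    (0 < i < K.*2)%N -> (0 < j < K.*2)%N ->
  ip01 (hybrid M b i) (hybrid M c j) = ((b == c) && (i == j))%:R.
Proof.
move=> /andP[M0 MK]; rewrite -(subnK MK); move: (K - M)%N => d {MK K}.
elim: d M M0 i j => [|d IHd] M M0 i j.
  rewrite add0n => /andP[i0 iM] /andP[j0 jM].
  rewrite /hybrid iM jM; case: (ltnP i M) => Mi; case: (ltnP j M) => Mj.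
  - exact: ip01_trig.
  - rewrite ip01C ip01_hat_trig0 ?(leq_trans Mi) ?orbT//.
    by rewrite [i == j]ltn_eqF ?andbF// (leq_trans Mi).
  - rewrite ip01_hat_trig0 ?(leq_trans Mj) ?orbT//.
    by rewrite [i == j]gtn_eqF ?andbF// (leq_trans Mj).
  - by rewrite ip01_hat_trig// (leq_trans iM, leq_trans jM)// leq_double.
rewrite addSnnS => iK jK.
(* The partner of an index stays in the range covered by the induction hypothesis. *)
have pK k : (0 < k < (d + M.+1).*2)%N -> (0 < rot_partner M k < (d + M.+1).*2)%N.
  rewrite /rot_partner; have [_ _|_] := eqVneq k M.
    by rewrite double_gt0 M0 ltn_double ltn_addl.
  have [_ _|//] := eqVneq k M.*2.
  by rewrite M0 -addnn (leq_trans _ (leq_addr _ _))// ltn_addl.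
rewrite (hybrid_rot b i M0) (hybrid_rot c j M0) ip01_bilin// !IHd ?pK//.
have M2 : (M == M.*2) = false by rewrite ltn_eqF// -addnn -[ltnLHS]addn0 ltn_add2l.
case: (b == c) => /=; last by rewrite !mulr0 !addr0.
rewrite /rot_diag /rot_off /rot_partner.
have M2' : (M.*2 == M) = false by rewrite eq_sym.
(* What remains is the orthonormality of the rows of the rotation, checked on nine cases with sq^2 +
   a^2 = 1. *)
have cases k : [\/ k = M, k = M.*2 |
    [/\ (k == M) = false, (k == M.*2) = false, (M == k) = false & (M.*2 == k) = false]].
  have [->|kM] := eqVneq k M; first by constructor 1.
  have [->|k2M] := eqVneq k M.*2; first by constructor 2.
  by constructor 3; split; rewrite // eq_sym; exact/negbTE.
case: (cases i) => [->|->|[? ? ? ?]]; case: (cases j) => [->|->|[? ? ? ?]];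
  rewrite ?eqxx; repeat match goal with E : (_ == _) = false |- _ => rewrite !E /= end;
  rewrite ?eqxx ?(mulr0, mulr1, mul0r, mul1r, addr0, add0r) ?sq2 // ?sq2; ring.
Qed.

Lemma ip01_tilde_trig b c i j : (0 < i)%N -> (0 < j)%N ->
  ip01 (tilde_trig a b i) (tilde_trig a c j) = ((b == c) && (i == j))%:R.
Proof.
(* At M = 1 the only positive index in a hat branch is 1, which is odd. *)
have E d k : (0 < k)%N -> tilde_trig a d k = hybrid 1 d k.
  by case: k => [//|[|k]] _ //; rewrite /hybrid /= tilde_trig_odd.
(* The choice K = i + j puts both indices below 2K. *)
move=> i0 j0; have ij2 : (i + j < (i + j).*2)%N.
  by rewrite -addnn -[ltnLHS]addn0 ltn_add2l addn_gt0 i0.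
rewrite (E b _ i0) (E c _ j0) (@ip01_hybrid 1 (i + j))//.
- by rewrite addn_gt0 i0.
- by rewrite i0 (leq_ltn_trans _ ij2)// leq_addr.
- by rewrite j0 (leq_ltn_trans _ ij2)// leq_addl.
Qed.

Lemma ip01_hat_trig_cst b i : (0 < i)%N -> ip01 (H b i) (fun=> 1) = 0.
Proof.
move=> i0; have [C C0 HC] := hat_trig_bound ha.
apply: (@eq0_of_decay R a ha _ (C * 1)) => N.
have b1 := bdd_measurable_cst (1 : R).
elim: N i i0 => [|N IHN] i i0; first by rewrite mul1r bound_ip// normr1.
rewrite HE ip01_lin// ip01_trig_cst// mulr0 add0r normrM exprS -mulrA ler_wpM2l//.
by rewrite IHN ?double_gt0.
Qed.

Lemma ip01_tilde_trig_cst b i : (0 < i)%N -> ip01 (tilde_trig a b i) (fun=> 1) = 0.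
Proof.
move=> i0; have [oi|ei] := boolP (odd i).
  by rewrite tilde_trig_odd// ip01_hat_trig_cst.
have E : tilde_trig a b i = (fun x => sq * H b i x + - a * T b i./2 x).
  apply/funext => x; rewrite -[in LHS](even_halfK ei) tilde_trig_double//.
  by rewrite even_halfK// mulNr.
rewrite E ip01_lin//; last exact: bdd_measurable_cst.
rewrite ip01_hat_trig_cst// ip01_trig_cst ?mulr0 ?addr0//.
by rewrite -double_gt0 even_halfK.
Qed.

Lemma sysF_some b n : sysF a (Some (b, n)) = tilde_trig a b n.+1.
Proof. by case: b. Qed.

Lemma bdd_measurable_sysF p : bdd_measurable (sysF a p).
Proof.
case: p => [[b n]|]; last exact: bdd_measurable_cst.
by rewrite sysF_some.
Qed.

Lemma orthonormal_sysF : orthonormal_L2_01 (sysF a).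
Proof.
move=> p q; have bpq := bdd_measurableM (bdd_measurable_sysF p) (bdd_measurable_sysF q).
have ipq := bdd_measurable_integrable bpq; split; first exact: ipq.
(* Integrability makes the extended integral finite, so it may be read as the real number [ip01]. *)
rewrite -[LHS]fineK; last by apply: integrable_fin_num ipq; exact: measurable_I01.
congr (_%:E); rewrite -[LHS]/(ip01 (sysF a p) (sysF a q)).
move: p q {bpq ipq} => [[b i]|] [[c j]|].
- by rewrite !sysF_some ip01_tilde_trig.
- by rewrite sysF_some ip01_tilde_trig_cst.
- by rewrite ip01C sysF_some ip01_tilde_trig_cst.
- rewrite /ip01; under eq_Rintegral do rewrite /= mul1r.
  rewrite Rintegral_cst; last exact: measurable_I01.
  by rewrite [X in fine X]mu_I01 mul1r.
Qed.

End Gram.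

(** * Finite linear combinations *)

Definition in_span {R : realType} {J : eqType} (e : J -> R -> R) (g : R -> R) : Prop :=
  exists l : seq (J * R), forall x, g x = \sum_(p <- l) p.2 * e p.1 x.

Section Span.
Context {R : realType} {J : eqType}.
Variable e : J -> R -> R.
Implicit Types (g h : R -> R) (r s : R).

Lemma in_span_base j : in_span e (e j).
Proof. by exists [:: (j, 1)] => x; rewrite big_seq1 mul1r. Qed.

Lemma in_span_lin r s g h : in_span e g -> in_span e h ->
  in_span e (fun x => r * g x + s * h x).
Proof.
move=> [l gl] [m hm].
exists ([seq (p.1, r * p.2) | p <- l] ++ [seq (p.1, s * p.2) | p <- m]) => x.
rewrite big_cat !big_map gl hm !mulr_sumr.
by congr (_ + _); apply: eq_bigr => p _; rewrite mulrA.
Qed.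

(** Lists with repeated indices make closure under linear combinations a concatenation, but
    completeness asks for one coefficient per index. The coefficients of equal indices are summed
    and duplicates removed. *)
Lemma in_span_combination g : in_span e g ->
  exists (s : seq J) (alpha : J -> R), forall x, g x = \sum_(j <- s) alpha j * e j x.
Proof.
move=> [l gl]; exists (undup (unzip1 l)), (fun j => \sum_(p <- l | p.1 == j) p.2) => x.
rewrite gl; under [RHS]eq_bigr do rewrite mulr_suml.
(* After the exchange, each pair [p] meets exactly one index of the duplicate-free list, namely
   [p.1]. *)
rewrite (exchange_big_dep xpredT)//= [LHS]big_seq [RHS]big_seq.
apply: eq_bigr => p pl; rewrite (big_rem p.1) /=; last first.
  by rewrite mem_undup; apply: map_f.
rewrite eqxx big1_seq ?addr0// => j /andP[/eqP <-].
by rewrite mem_rem_uniq ?undup_uniq// inE eqxx.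
Qed.

End Span.

(** * The algebra of trigonometric polynomials *)

Section TrigPoly.
Context {R : realType}.
Implicit Types (f g : R -> R) (r s x : R) (i j k : nat).

Inductive trig_poly : (R -> R) -> Prop :=
| trig_poly_trig b k : trig_poly (trig b k)
| trig_poly_lin r s f g : trig_poly f -> trig_poly g ->
    trig_poly (fun x => r * f x + s * g x).

Lemma trig_polyZ r f : trig_poly f -> trig_poly (fun x => r * f x).
Proof.
move=> tf; rewrite (_ : (fun x => _) = (fun x => r * f x + 0 * f x)).
  exact: trig_poly_lin.
by apply/funext => x; rewrite mul0r addr0.
Qed.

Lemma trig_polyD f g : trig_poly f -> trig_poly g -> trig_poly (fun x => f x + g x).
Proof.
move=> tf tg; rewrite (_ : (fun x => _) = (fun x => 1 * f x + 1 * g x)).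
  exact: trig_poly_lin.
by apply/funext => x; rewrite !mul1r.
Qed.

Lemma trig_polyB f g : trig_poly f -> trig_poly g -> trig_poly (fun x => f x - g x).
Proof.
move=> tf tg; rewrite (_ : (fun x => _) = (fun x => 1 * f x + -1 * g x)).
  exact: trig_poly_lin.
by apply/funext => x; rewrite mul1r mulN1r.
Qed.

Let sqrt2_neq0 : Num.sqrt 2 != 0 :> R.
Proof. by rewrite sqrtr_eq0 -ltNge. Qed.

Lemma trig_poly_cos k : trig_poly (fun x => cos (2 * k%:R * pi * x)).
Proof.
rewrite (_ : (fun x => _) = (fun x => (Num.sqrt 2)^-1 * trig true k x)).
  exact/trig_polyZ/trig_poly_trig.
by apply/funext => x; rewrite /trig /ck mulKf.
Qed.

Lemma trig_poly_sin k : trig_poly (fun x => sin (2 * k%:R * pi * x)).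
Proof.
rewrite (_ : (fun x => _) = (fun x => (Num.sqrt 2)^-1 * trig false k x)).
  exact/trig_polyZ/trig_poly_trig.
by apply/funext => x; rewrite /trig /sk mulKf.
Qed.

Lemma trig_poly_cst r : trig_poly (fun=> r).
Proof.
rewrite (_ : (fun=> r) = (fun x => r * cos (2 * 0%:R * pi * x))).
  exact/trig_polyZ/trig_poly_cos.
by apply/funext => x; rewrite mulr0 !mul0r cos0 mulr1.
Qed.

(** Frequencies are natural numbers, so a negative difference is reversed by parity: cosine is even,
    while sine, in the next lemma, costs a factor -1. *)
Let trig_poly_cosB i j : trig_poly (fun x => cos ((2 * i%:R * pi - 2 * j%:R * pi) * x)).
Proof.
wlog ij : i j / (j <= i)%N => [H|].
  have [/H//|/ltnW /H] := leqP j i.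
  rewrite (_ : (fun x => _) = (fun x => cos ((2 * i%:R * pi - 2 * j%:R * pi) * x)))//.
  by apply/funext => x; rewrite -cosN -mulNr opprB.
rewrite (_ : (fun x => _) = (fun x => cos (2 * (i - j)%:R * pi * x))).
  exact: trig_poly_cos.
by apply/funext => x; rewrite natrB//; congr cos; ring.
Qed.

Let trig_poly_sinB i j : trig_poly (fun x => sin ((2 * i%:R * pi - 2 * j%:R * pi) * x)).
Proof.
wlog ij : i j / (j <= i)%N => [H|].
  have [/H//|/ltnW /H /(trig_polyZ (-1))] := leqP j i.
  rewrite (_ : (fun x => _) = (fun x => sin ((2 * i%:R * pi - 2 * j%:R * pi) * x)))//.
  by apply/funext => x; rewrite mulN1r -sinN -mulNr opprB.
rewrite (_ : (fun x => _) = (fun x => sin (2 * (i - j)%:R * pi * x))).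
  exact: trig_poly_sin.
by apply/funext => x; rewrite natrB//; congr sin; ring.
Qed.

Let trig_poly_cosD i j : trig_poly (fun x => cos ((2 * i%:R * pi + 2 * j%:R * pi) * x)).
Proof.
rewrite (_ : (fun x => _) = (fun x => cos (2 * (i + j)%:R * pi * x))).
  exact: trig_poly_cos.
by apply/funext => x; rewrite natrD//; congr cos; ring.
Qed.

Let trig_poly_sinD i j : trig_poly (fun x => sin ((2 * i%:R * pi + 2 * j%:R * pi) * x)).
Proof.
rewrite (_ : (fun x => _) = (fun x => sin (2 * (i + j)%:R * pi * x))).
  exact: trig_poly_sin.
by apply/funext => x; rewrite natrD//; congr sin; ring.
Qed.

Let trig_poly_trigM b c i j : trig_poly (fun x => trig b i x * trig c j x).
Proof.
have sc k l : trig_poly (fun x => sk k x * ck l x).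
  under [X in trig_poly X]eq_fun do rewrite sk_ckM.
  exact: trig_polyD.
case: b; case: c; rewrite /trig.
- under [X in trig_poly X]eq_fun do rewrite ckM.
  exact: trig_polyD.
- under [X in trig_poly X]eq_fun do rewrite mulrC.
  exact: sc.
- exact: sc.
- under [X in trig_poly X]eq_fun do rewrite skM.
  exact: trig_polyB.
Qed.

Lemma trig_polyM f g : trig_poly f -> trig_poly g -> trig_poly (fun x => f x * g x).
Proof.
move=> tf tg; elim: tf => [b i|r s f1 f2 _ IH1 _ IH2]; last first.
  under [X in trig_poly X]eq_fun do rewrite mulrDl -!mulrA.
  exact: trig_poly_lin.
elim: tg => [c j|r s g1 g2 _ IH1 _ IH2]; first exact: trig_poly_trigM.
under [X in trig_poly X]eq_fun do rewrite mulrDr !(mulrCA _ r) !(mulrCA _ s).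
exact: trig_poly_lin.
Qed.

Lemma trig_polyX n f : trig_poly f -> trig_poly (fun x => f x ^+ n).
Proof.
move=> tf; elim: n => [|n IHn].
  under [X in trig_poly X]eq_fun do rewrite expr0; exact: trig_poly_cst.
under [X in trig_poly X]eq_fun do rewrite exprS; exact: trig_polyM.
Qed.

Lemma bdd_measurable_trig_poly f : trig_poly f -> bdd_measurable f.
Proof.
elim=> [b k|r s g h _ bg _ bh]; first exact: bdd_measurable_trig.
by apply: bdd_measurableD; exact: bdd_measurableZ.
Qed.

Section SysF.
Variable a : R.
Hypothesis ha : `|a| < 1.

(** For even k the definition of tilde_k reads hat_k = sq tilde_k + a hat_(k/2). Halving ends at an
    odd index, where hat and tilde coincide. *)
Lemma hat_trig_in_span b k : (0 < k)%N -> in_span (sysF a) (hat_trig a b k).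
Proof.
elim/ltn_ind: k => k IHk k0.
have st : in_span (sysF a) (tilde_trig a b k).
  by rewrite -(prednK k0) -sysF_some; exact: in_span_base.
have [ok|ek] := boolP (odd k); first by rewrite -tilde_trig_odd.
have k20 : (0 < k./2)%N by rewrite -double_gt0 even_halfK.
have sh : in_span (sysF a) (hat_trig a b k./2).
  by apply: IHk => //; rewrite -[ltnRHS](even_halfK ek) -addnn -[ltnLHS]addn0 ltn_add2l.
rewrite (_ : hat_trig a b k = fun x =>
  Num.sqrt (1 - a ^+ 2) * tilde_trig a b k x + a * hat_trig a b k./2 x).
  exact: in_span_lin.
apply/funext => x; rewrite /tilde_trig /tildeF (negbTE ek).
by rewrite mulrC divfK ?sqrt_onem_sqr_neq0// subrK.
Qed.

(** The recurrence solved for f_k gives f_k = (hat_k - a hat_(2k)) / sq when k > 0. *)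
Lemma trig_poly_in_span f : trig_poly f -> in_span (sysF a) f.
Proof.
elim=> [b k|r s g h _ sg _ sh]; last exact: in_span_lin.
have [->|k0] := posnP k.
  have s1 : in_span (sysF a) (fun=> 1) by exact: (in_span_base (sysF a) None).
  (* At frequency 0 the cosine is the constant [Num.sqrt 2] and the sine is 0; [b%:R] covers
     both. *)
  have c0 : trig b 0 = (fun x : R => (b%:R * Num.sqrt 2) * 1 + 0 * 1).
    apply/funext => x; case: b;
    by rewrite /trig /ck /sk mulr0 !mul0r ?cos0 ?sin0 ?mulr0 ?mul1r ?addr0.
  by rewrite c0; exact: in_span_lin.
set sq := Num.sqrt (1 - a ^+ 2).
rewrite (_ : trig b k = fun x =>
  sq^-1 * hat_trig a b k x + - (sq^-1 * a) * hat_trig a b k.*2 x).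
  by apply: in_span_lin; apply: hat_trig_in_span; rewrite ?double_gt0.
apply/funext => x; rewrite (hat_trig_rec ha b k) mulrDr mulKf ?sqrt_onem_sqr_neq0//.
by rewrite mulrA mulNr addrK.
Qed.

End SysF.

End TrigPoly.

(** * Mean-square approximation by trigonometric polynomials *)

Definition sqnorm {R : realType} (f : R -> R) : \bar R :=
  (\int[@lebesgue_measure R]_(x in @I01 R) ((f x) ^+ 2)%:E)%E.

Definition trig_approximable {R : realType} (f : R -> R) : Prop :=
  measurable_fun (@I01 R) f /\ forall eps : R, 0 < eps ->
    exists g, trig_poly g /\ (sqnorm (fun x => (f x - g x)%R) < eps%:E)%E.

Section TrigDensity.
Context {R : realType}.
Implicit Types (f g : R -> R) (r s x : R).
Local Notation mu := (@lebesgue_measure R).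
Local Notation I := (@I01 R).
Let mI : measurable I := @measurable_I01 R.

Let measurable_sqr f : measurable_fun I f ->
  measurable_fun I (fun x => ((f x) ^+ 2)%:E).
Proof. by move=> mf; apply/measurable_EFinP; exact: measurable_funX. Qed.

Let measurable_trig_poly f : trig_poly f -> measurable_fun I f.
Proof. by move=> /bdd_measurable_trig_poly[mf _]; exact: measurable_funTS. Qed.

Let measurable_lin r s f g : measurable_fun I f -> measurable_fun I g ->
  measurable_fun I (fun x => r * f x + s * g x).
Proof. by move=> mf mg; apply: measurable_funD; apply: measurable_funM. Qed.

(** Pointwise (u + v)^2 <= 2 u^2 + 2 v^2, the gap being (u - v)^2. This replaces the triangle
    inequality without square roots. *)
Lemma sqnorm_lin r s f g : measurable_fun I f -> measurable_fun I g ->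
  (sqnorm (fun x => (r * f x + s * g x)%R) <=
    (2 * r ^+ 2)%:E * sqnorm f + (2 * s ^+ 2)%:E * sqnorm g)%E.
Proof.
move=> mf mg; rewrite /sqnorm.
have sq0 (h : R -> R) x : (0 <= ((h x) ^+ 2)%:E)%E by rewrite lee_fin sqr_ge0.
have c0 (t : R) : 0 <= 2 * t ^+ 2 by rewrite mulr_ge0// sqr_ge0.
rewrite -!ge0_integralZl_EFin//; try exact: measurable_sqr.
rewrite -ge0_integralD//; last 4 first.
- by move=> x _; rewrite mule_ge0// lee_fin.
- by apply: measurable_funeM; exact: measurable_sqr.
- by move=> x _; rewrite mule_ge0// lee_fin.
- by apply: measurable_funeM; exact: measurable_sqr.
apply: ge0_le_integral => //.
- by apply: measurable_sqr; exact: measurable_lin.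
- by apply: emeasurable_funD; apply: measurable_funeM; exact: measurable_sqr.
move=> x _; rewrite -!EFinM -EFinD lee_fin -subr_ge0.
rewrite (_ : _ - _ = (r * f x - s * g x) ^+ 2) ?sqr_ge0//; ring.
Qed.

Let sqnorm_lin_lt r s f g d e : measurable_fun I f -> measurable_fun I g ->
  (sqnorm f < d%:E)%E -> (sqnorm g < d%:E)%E ->
  2 * (r ^+ 2 + s ^+ 2) * d < e ->
  (sqnorm (fun x => (r * f x + s * g x)%R) < e%:E)%E.
Proof.
move=> mf mg fd gd de; apply: le_lt_trans (sqnorm_lin r s mf mg) _.
have c0 (t : R) : (0 <= (2 * t ^+ 2)%:E)%E by rewrite lee_fin mulr_ge0// sqr_ge0.
apply: le_lt_trans (_ : _ <= (2 * (r ^+ 2 + s ^+ 2) * d)%:E)%E _; last by rewrite lte_fin.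
rewrite mulrDr mulrDl EFinD !(EFinM _ d).
by apply: leeD; apply: lee_wpmul2l => //; exact: ltW.
Qed.

Lemma trig_approximable_trig_poly f : trig_poly f -> trig_approximable f.
Proof.
move=> tf; split => [|e e0]; first exact: measurable_trig_poly.
exists f; split => //; rewrite /sqnorm.
under eq_integral do rewrite subrr expr0n /=.
by rewrite integral0 lte_fin.
Qed.

Lemma trig_approximable_lin r s f g :
  trig_approximable f -> trig_approximable g ->
  trig_approximable (fun x => r * f x + s * g x).
Proof.
move=> [mf af] [mg ag]; split => [|e e0]; first exact: measurable_lin.
have q0 : 0 <= r ^+ 2 + s ^+ 2 by rewrite addr_ge0 ?sqr_ge0.
(* The added 1 keeps the denominator positive when r = s = 0 and makes the final bound strict. *)
pose d := e / (2 * (r ^+ 2 + s ^+ 2) + 1).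
have p0 : 0 < 2 * (r ^+ 2 + s ^+ 2) + 1 by rewrite ltr_wpDl// mulr_ge0.
have d0 : 0 < d by rewrite divr_gt0.
have [p [tp fp]] := af _ d0; have [q [tq gq]] := ag _ d0.
exists (fun x => r * p x + s * q x); split; first exact: trig_poly_lin.
rewrite (_ : (fun x => _) = (fun x => r * (f x - p x) + s * (g x - q x))); last first.
  by apply/funext => x; ring.
apply: sqnorm_lin_lt fp gq _.
- by apply: measurable_funB => //; exact: measurable_trig_poly.
- by apply: measurable_funB => //; exact: measurable_trig_poly.
- by rewrite /d mulrA ltr_pdivrMr// mulrC ltr_pM2l// ltrDl.
Qed.

Lemma trig_approximable_sum (n : nat) (c : 'I_n -> R) (h : 'I_n -> R -> R) :
  (forall i, trig_approximable (h i)) ->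
  trig_approximable (fun x => \sum_(i < n) c i * h i x).
Proof.
elim: n c h => [|n IHn] c h ah.
  under [X in trig_approximable X]eq_fun do rewrite big_ord0.
  exact/trig_approximable_trig_poly/trig_poly_cst.
under [X in trig_approximable X]eq_fun do rewrite big_ord_recl -[X in _ + X]mul1r.
exact: trig_approximable_lin (IHn _ _ (fun i => ah (lift ord0 i))).
Qed.

(** Dominated convergence sends the squared distance from [f] to [g n] to 0; a trigonometric
    polynomial close to a late [g n] is then close to [f]. *)
Lemma trig_approximable_cvg f (g : nat -> R -> R) (G : R -> R) :
  measurable_fun I f -> (forall n, trig_approximable (g n)) ->
  mu.-integrable I (EFin \o G) ->
  (forall n x, I x -> (f x - g n x) ^+ 2 <= G x) ->
  {ae mu, forall x, I x -> g ^~ x @ \oo --> f x} ->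
  trig_approximable f.
Proof.
move=> mf ag iG fgG gf; split => // e e0.
have mg n : measurable_fun I (g n) by have [] := ag n.
pose v n x := ((f x - g n x) ^+ 2)%:E.
have v0 : {ae mu, forall x, I x -> v ^~ x @ \oo --> 0%E}.
  move: gf => [N [mN N0 gfN]]; exists N; split => // x /= vx; apply: gfN => gfx; apply: vx => Ix.
  apply: cvg_EFin; first exact: nearW.
  rewrite (_ : fine \o _ = fun n => (f x - g n x) ^+ 2)//.
  rewrite (_ : 0 = (f x - f x) ^+ 2); last by rewrite subrr expr0n.
  apply: (@cvg_comp _ _ _ (fun n => f x - g n x) (fun y => y ^+ 2)).
    by apply: cvgB; [exact: cvg_cst|exact: gfx].
  exact: exprn_continuous.
have vG : {ae mu, forall x n, I x -> (`|v n x| <= (EFin \o G) x)%E}.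
  by apply: aeW => x n Ix; rewrite gee0_abs ?lee_fin ?sqr_ge0// fgG.
have mv n : measurable_fun I (v n) by exact: measurable_sqr (measurable_funB mf (mg n)).
have [_ _] := @dominated_convergence _ _ R mu I mI v (cst 0%E) (EFin \o G)
  mv (measurable_cst 0%E) v0 iG vG.
rewrite integral0 => vcv.
(* With r = s = 1 the combined error is below 4d, so any d < e / 4 works. *)
pose d := e / 5%:R; have d0 : 0 < d by rewrite divr_gt0.
have [n vn] : exists n, (sqnorm (fun x => f x - g n x)%R < d%:E)%E.
  have : \forall n \near \oo, (\int[mu]_(x in I) v n x < d%:E)%E.
    exact: (vcv _ (@nbhs_open_ereal_lt R 0 (fun=> d) d0)).
  by move=> /filter_ex [n vn]; exists n.
have [p [tp gp]] := (ag n).2 _ d0.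
exists p; split => //.
rewrite (_ : (fun x => _) = (fun x => 1 * (f x - g n x) + 1 * (g n x - p x))); last first.
  by apply/funext => x; ring.
apply: sqnorm_lin_lt vn gp _.
- exact: measurable_funB.
- by apply: measurable_funB => //; exact: measurable_trig_poly.
- by rewrite /d expr1n; lra.
Qed.

End TrigDensity.

(** * Powers converging to a step at 1/2 *)

Section StepLimit.
Context {R : realType}.
Implicit Types (u t : R) (n m : nat).

Lemma bernoulli_pow_ge m t : -1 <= t -> 1 + m%:R * t <= (1 + t) ^+ m.
Proof.
move=> t1; have t0 : 0 <= 1 + t by rewrite -lerBlDl sub0r.
elim: m => [|m IHm]; first by rewrite mul0r addr0.
rewrite exprS (le_trans _ (ler_wpM2l t0 IHm))// -subr_ge0 -natr1.
rewrite (_ : _ - _ = m%:R * t ^+ 2); last by ring.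
by rewrite mulr_ge0// sqr_ge0.
Qed.

(** Bernoulli gives m t <= (1 + t)^m, and (1 - t)^m (1 + t)^m = (1 - t^2)^m <= 1. The product form
    avoids dividing by m t. *)
Lemma pow_onem_le m t : 0 <= t <= 1 -> (1 - t) ^+ m * (m%:R * t) <= 1.
Proof.
move=> /andP[t0 t1].
have h : m%:R * t <= (1 + t) ^+ m.
  apply: le_trans (bernoulli_pow_ge m _); first by rewrite lerDr.
  by rewrite (le_trans _ t0)// lerN10.
have o0 : 0 <= (1 - t) ^+ m by rewrite exprn_ge0// subr_ge0.
apply: le_trans (ler_wpM2l o0 h) _.
rewrite -exprMn exprn_ile1//.
  by rewrite mulr_ge0 ?subr_ge0// addr_ge0.
by rewrite (_ : _ * _ = 1 - t ^+ 2) ?lerBlDr ?lerDl ?sqr_ge0//; ring.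
Qed.

(** A polynomial known from proofs of the Stone-Weierstrass theorem. Its behaviour is governed by
    2^n u^n = (2u)^n, whence the threshold 1/2. *)
Definition step_pow u n : R := (1 - u ^+ n) ^+ (2 ^ n).

Lemma step_pow01 u n : 0 <= u <= 1 -> 0 <= step_pow u n <= 1.
Proof.
move=> /andP[u0 u1]; have un : 0 <= u ^+ n <= 1 by rewrite exprn_ge0// exprn_ile1.
have /andP[un0 un1] := un; rewrite /step_pow exprn_ge0 ?subr_ge0//=.
by rewrite exprn_ile1 ?subr_ge0// lerBlDr lerDl.
Qed.

(** Squeeze: Bernoulli bounds the power below by 1 - (2u)^n. *)
Lemma step_pow_cvg1 u : 0 <= u < 1/2 -> step_pow u @ \oo --> (1 : R).
Proof.
move=> /andP[u0 u2]; have u01 : 0 <= u <= 1 by rewrite u0; lra.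
have u2n : (fun n => 1 - geometric 1 (2 * u) n) @ \oo --> (1 : R).
  rewrite -[X in _ --> X]subr0; apply: cvgB; first exact: cvg_cst.
  by apply: cvg_geometric; rewrite ger0_norm ?mulr_ge0//; lra.
apply: squeeze_cvgr u2n (@cvg_cst _ _ _ _ _); apply: nearW => n.
have /andP[_ ->] := step_pow01 n u01; rewrite andbT /step_pow /= mul1r.
have un1 : u ^+ n <= 1 by rewrite exprn_ile1//; lra.
apply: le_trans (bernoulli_pow_ge (2 ^ n) _); last by rewrite lerN2.
by rewrite mulrN natrX exprMn.
Qed.

(** Squeeze: [pow_onem_le] with t = u^n and m = 2^n bounds the power above by (2u)^(-n). *)
Lemma step_pow_cvg0 u : 1/2 < u <= 1 -> step_pow u @ \oo --> (0 : R).
Proof.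
move=> /andP[u2 u1]; have u01 : 0 <= u <= 1 by lra.
have u0 : 0 < 2 * u by lra.
have u2n : (fun n => geometric 1 (2 * u)^-1 n) @ \oo --> (0 : R).
  by apply: cvg_geometric; rewrite ger0_norm ?invr_ge0 ?ltW// invf_lt1//; lra.
apply: squeeze_cvgr (@cvg_cst _ _ _ _ _) u2n; apply: nearW => n.
have /andP[-> _] := step_pow01 n u01; rewrite /step_pow /= mul1r exprVn.
rewrite -[leRHS]mul1r ler_pdivlMr ?exprn_gt0// exprMn -natrX.
apply: pow_onem_le; case/andP: u01 => u0' _.
by rewrite exprn_ge0// exprn_ile1.
Qed.

End StepLimit.

(** * Approximation of indicators of rays *)

Section Ray.
Context {R : realType}.
Implicit Types (q x : R).
Local Notation mu := (@lebesgue_measure R).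
Local Notation I := (@I01 R).

(* On [0, 1] the product is positive exactly on ]0, q[, and product-to-sum
   formulas make it a trigonometric polynomial of degree 1. *)
Let ray_poly q x : R := 1/2 - sin (pi * x) * sin (pi * (q - x)) / 2.

Let ray_poly01 q x : 0 <= ray_poly q x <= 1.
Proof.
have : `|sin (pi * x) * sin (pi * (q - x))| <= 1.
  by rewrite normrM mulr_ile1 ?sin_max.
by rewrite ler_norml /ray_poly; lra.
Qed.

Let trig_poly_ray_poly q : trig_poly (ray_poly q).
Proof.
have E : ray_poly q = (fun x => - (cos (pi * q) / 4) * cos (2 * 1%:R * pi * x)
    + 1 * (- (sin (pi * q) / 4) * sin (2 * 1%:R * pi * x)
    + 1 * (1/2 + cos (pi * q) / 4))).
  apply/funext => x; rewrite /ray_poly mulrBr sinB.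
  rewrite (_ : 2 * 1%:R * pi * x = (pi * x) *+ 2); last by rewrite -mulr_natl; ring.
  rewrite cos_mulr2n sin_mulr2n.
  have := sin2cos2 (pi * x); set c := cos (pi * x); set s := sin (pi * x) => sc.
  rewrite (_ : s * (sin (pi * q) * c - cos (pi * q) * s) =
    s * c * sin (pi * q) - s ^+ 2 * cos (pi * q)); last by ring.
  by rewrite sc; field.
rewrite E; apply: trig_poly_lin; first exact: trig_poly_cos.
apply: (trig_polyD (f := fun x => _ * sin _)).
  exact/trig_polyZ/trig_poly_sin.
exact: trig_poly_cst.
Qed.

Let sin_pi_gt0 x : 0 < x < 1 -> 0 < sin (pi * x).
Proof.
move=> /andP[x0 x1]; apply: sin_gt0_pi.
by rewrite mulr_gt0 ?pi_gt0//= -[ltRHS]mulr1 ltr_pM2l ?pi_gt0.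
Qed.

Lemma trig_approximable_ray q : 0 < q <= 1 -> trig_approximable (\1_(`]-oo, q[%classic) : R -> R).
Proof.
move=> /andP[q0 q1].
(* At these three points the product of sines vanishes and [ray_poly] equals 1/2, where no limit of
   [step_pow] has been established. They form a null set. *)
pose N : set R := [set 0] `|` [set q] `|` [set 1].
have muN : mu N = 0%E.
  apply: countable_lebesgue_measure0; apply: finite_set_countable.
  by rewrite !finite_setU.
have mN : measurable N by apply: measurableU => //; exact: measurableU.
apply: (@trig_approximable_cvg _ _ (fun n x => step_pow (ray_poly q x) n) (fun=> 1)).
- by apply: measurable_funTS; exact: measurable_indic.
- move=> n; apply: trig_approximable_trig_poly; apply: trig_polyX.
  by apply: trig_polyB; [exact: trig_poly_cst|exact: trig_polyX].
- exact/bdd_measurable_integrable/bdd_measurable_cst.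
- move=> n x _; have := step_pow01 n (ray_poly01 q x).
  move: (step_pow _ _) => s s01; rewrite -[leLHS]real_normK ?num_real// expr_le1//.
  by rewrite ler_norml indicE; case: (_ \in _) => /=; lra.
exists N; split => // x /= Nx; apply: contrapT => xN; apply: Nx.
rewrite /I01 /= in_itv /= => /andP[x0 x1].
have {x0} x0 : 0 < x.
  by rewrite lt_neqAle x0 andbT eq_sym; apply/eqP => E; apply: xN; left; left.
have {x1} x1 : x < 1.
  by rewrite lt_neqAle x1 andbT; apply/eqP => E; apply: xN; right.
have sx : 0 < sin (pi * x) by rewrite sin_pi_gt0// x0.
rewrite indicE; have [xq|qx|E] := ltgtP x q; last by exfalso; apply: xN; left; right.
- rewrite mem_set/= ?in_itv//; apply: step_pow_cvg1.
  have /andP[-> _] /= := ray_poly01 q x.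
  have : 0 < sin (pi * (q - x)) by rewrite sin_pi_gt0//; lra.
  by move=> /(mulr_gt0 sx); rewrite /ray_poly; lra.
- rewrite memNset/= ?in_itv/= ?ltNge ?(ltW qx)//; apply: step_pow_cvg0.
  have /andP[_ ->] /= := ray_poly01 q x; rewrite andbT.
  (* Beyond [q] the second sine changes sign by oddness, so [ray_poly] exceeds 1/2. *)
  have : 0 < sin (pi * (x - q)) by rewrite sin_pi_gt0//; lra.
  rewrite -opprB mulrN sinN => /(mulr_gt0 sx); rewrite mulrN /ray_poly; lra.
Qed.

End Ray.

(** * From rays to measurable sets and to all of L^2 *)

Section Completeness.
Context {R : realType}.
Implicit Types (f : R -> R) (q x : R) (A : set R).
Local Notation mu := (@lebesgue_measure R).
Local Notation I := (@I01 R).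
Let mI : measurable I := @measurable_I01 R.
Import HBNNSimple.

Lemma trig_approximable_eq f g : {in I, f =1 g} ->
  trig_approximable f -> trig_approximable g.
Proof.
move=> fg [mf af]; split; first exact: eq_measurable_fun mf.
move=> e e0; have [p [tp fp]] := af e e0; exists p; split => //.
rewrite /sqnorm; under eq_integral => x xI do rewrite -fg//.
exact: fp.
Qed.

(** For q outside ]0, 1] the indicator is constant on [0, 1]. *)
Let trig_approximable_rayT q :
  trig_approximable (\1_(`]-oo, q[%classic) : R -> R).
Proof.
have [q0|q0] := leP q 0.
  apply: trig_approximable_eq (trig_approximable_trig_poly (trig_poly_cst 0)).
  move=> x; rewrite inE /I01 /= in_itv /= => /andP[x0 _].
  by rewrite indicE memNset//= in_itv /= ltNge (le_trans q0).
have [q1|q1] := leP q 1; first by apply: trig_approximable_ray; rewrite q0.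
apply: trig_approximable_eq (trig_approximable_trig_poly (trig_poly_cst 1)).
move=> x; rewrite inE /I01 /= in_itv /= => /andP[_ x1].
by rewrite indicE mem_set//= in_itv /= (le_lt_trans x1).
Qed.

(** Open left rays are stable under intersection and generate the Borel sets. The approximable sets
    form a lambda-system: proper differences follow by linearity, increasing unions by dominated
    convergence. *)
Lemma trig_approximable_indic A : measurable A ->
  trig_approximable (\1_A : R -> R).
Proof.
move=> mA.
have setIG : setI_closed (@RGenInftyO.G R).
  move=> _ _ [x ->] [y ->]; exists (Num.min x y); apply/seteqP; split => z /=.
    by rewrite !in_itv /= lt_min => -[-> ->].
  by rewrite !in_itv /= lt_min => /andP[].
pose H : set (set R) := [set A | measurable A /\ trig_approximable (\1_A : R -> R)].
suff : <<s @RGenInftyO.G R >> `<=` H.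
  move=> /(_ A) []//.
  exact: (eq_ind _ (fun S : set (set R) => S A) mA _ (RGenInftyO.measurableE R)).
apply: lambda_system_subset => //; last first.
  by move=> _ [q ->]; split; [exact: measurable_itv|exact: trig_approximable_rayT].
split => //.
- split => //; apply: trig_approximable_eq (trig_approximable_trig_poly (trig_poly_cst 1)).
  by move=> x _; rewrite indicT.
- move=> B C CB [mB aB] [mC aC]; split; first exact: measurableD.
  apply: trig_approximable_eq (trig_approximable_lin 1 (-1) aB aC) => x _.
  rewrite mul1r mulN1r !indicE in_setD.
  have [xC|xC] := boolP (x \in C); last by rewrite andbT subr0.
  by rewrite andbF (mem_set (CB _ (set_mem xC))) subrr.
- move=> F ndF HF; have mF : measurable (\bigcup_n F n).
    by apply: bigcup_measurable => n _; have [] := HF n.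
  split => //.
  apply: (@trig_approximable_cvg _ _ (fun n => \1_(F n)) (fun=> 1)).
  + by apply: measurable_funTS; exact: measurable_indic.
  + by move=> n; have [] := HF n.
  + exact/bdd_measurable_integrable/bdd_measurable_cst.
  + move=> n x _; rewrite !indicE.
    by case: (_ \in _); case: (_ \in _);
      rewrite ?subr0 ?subrr ?sub0r ?sqrrN ?expr1n ?expr0n ?ler01.
  apply: aeW => x _; rewrite indicE.
  (* For an increasing sequence of sets the indicators are eventually constant at each point. *)
  have [|xF] := boolP (x \in \bigcup_n F n).
    move=> /set_mem [N _ FNx]; apply: cvg_near_cst; exists N => // n /= Nn.
    by rewrite indicE mem_set//; exact: (subsetPset _ _ (ndF _ _ Nn)).
  apply: cvg_near_cst; apply: nearW => n; rewrite indicE memNset// => Fnx.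
  by move/negP: xF; apply; apply/mem_set; exists n.
Qed.

Let sqnorm_integrable f : measurable_fun I f -> (sqnorm f < +oo)%E ->
  mu.-integrable I (EFin \o (fun x => f x ^+ 2)).
Proof.
move=> mf foo; apply/integrableP; split.
  by apply/measurable_EFinP; exact: measurable_funX.
under eq_integral do rewrite /= ger0_norm ?sqr_ge0//.
exact: foo.
Qed.

(** Simple functions g_n increase to [f], and 0 <= g_n <= f gives (f - g_n)^2 <= f^2, an integrable
    bound. *)
Lemma trig_approximable_ge0 f : (forall x, 0 <= f x) -> measurable_fun I f ->
  (sqnorm f < +oo)%E -> trig_approximable f.
Proof.
move=> f0 mf foo.
have mEf : measurable_fun I (EFin \o f) by exact/measurable_EFinP.
have f0' x : I x -> (0 <= (EFin \o f) x)%E by rewrite lee_fin.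
pose g n : R -> R := nnsfun_approx mI mEf n.
have gf x : I x -> g ^~ x @ \oo --> f x.
  by move=> Ix; have /fine_cvg := cvg_nnsfun_approx mI mEf f0' Ix.
have gle n x : I x -> g n x <= f x.
  by move=> Ix; rewrite /g nnsfun_approxE -lee_fin; exact: le_approx.
apply: (@trig_approximable_cvg _ _ g (fun x => f x ^+ 2)) => //.
(* A simple function is the finite sum of its values times the indicators of its fibres. *)
- move=> n; apply: trig_approximable_eq (_ : trig_approximable (fun x => _)).
    by move=> x _; rewrite [RHS]fimfunEord.
  apply: trig_approximable_sum => i; apply: trig_approximable_indic.
  exact: measurable_sfunP.
- exact: sqnorm_integrable.
- move=> n x Ix; have g0 : 0 <= g n x by [].
  rewrite lerXn2r ?nnegrE ?subr_ge0 ?gle// lerBlDr lerDl//.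
- by apply: aeW.
Qed.

(** Positive and negative parts are treated separately; the square of each is at most f^2. *)
Lemma trig_approximable_L2 f : measurable_fun I f -> (sqnorm f < +oo)%E ->
  trig_approximable f.
Proof.
move=> mf foo.
have sq_le (h : R -> R) : measurable_fun I h -> (forall x, h x ^+ 2 <= f x ^+ 2) ->
    (sqnorm h < +oo)%E.
  move=> mh hf; apply: le_lt_trans foo; apply: ge0_le_integral => //.
  - by move=> x _; rewrite lee_fin sqr_ge0.
  - by apply/measurable_EFinP; exact: measurable_funX.
  - by apply/measurable_EFinP; exact: measurable_funX.
  - by move=> x _; rewrite lee_fin.
pose p x := Num.max (f x) 0; pose n x := Num.max (- f x) 0.
have mp : measurable_fun I p by exact: measurable_maxr.
have mn : measurable_fun I n by apply: measurable_maxr => //; exact: measurable_funN.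
have ap : trig_approximable p.
  apply: trig_approximable_ge0 => //; first by move=> x; rewrite le_max lexx orbT.
  apply: sq_le => // x; rewrite /p; case: (leP (f x) 0) => // _.
  by rewrite expr0n sqr_ge0.
have an : trig_approximable n.
  apply: trig_approximable_ge0 => //; first by move=> x; rewrite le_max lexx orbT.
  apply: sq_le => // x; rewrite /n; case: (leP (- f x) 0) => // _; last by rewrite sqrrN.
  by rewrite expr0n sqr_ge0.
apply: trig_approximable_eq (trig_approximable_lin 1 (-1) ap an) => x _.
by rewrite mul1r mulN1r /p /n; case: (leP (f x)); case: (leP (- f x)); lra.
Qed.

Lemma complete_sysF (a : R) : `|a| < 1 -> complete_L2_01 (sysF a).
Proof.
move=> ha f mf foo e e0.
have [_ /(_ e e0) [g [tg fg]]] := trig_approximable_L2 mf foo.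
have [s [alpha galpha]] := in_span_combination (trig_poly_in_span ha tg).
exists s, alpha; move: fg; rewrite /sqnorm.
by under eq_integral do rewrite galpha.
Qed.

End Completeness.

Unset Implicit Arguments.
Set Strict Implicit.

Theorem theorem5p2 (R : realType) (a : R) (ha : `|a| < 1) :
  orthonormal_L2_01 (sysF a) /\ complete_L2_01 (sysF a) /\
  (forall i : nat, (0 < i)%N -> ~~ odd i -> forall x : R,
     (chat a i x - a * chat a i./2 x) / Num.sqrt (1 - a ^+ 2)
       = Num.sqrt (1 - a ^+ 2) * chat a i x - a * ck i./2 x /\
     (shat a i x - a * shat a i./2 x) / Num.sqrt (1 - a ^+ 2)
       = Num.sqrt (1 - a ^+ 2) * shat a i x - a * sk i./2 x).
Proof.
split; first exact: orthonormal_sysF.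
split; first exact: complete_sysF.
move=> i _ ei x.
(* At the half of an even [i], the left side unfolds to the quotient and the right side is the
   second formula. *)
have E b := tilde_trig_double ha b i./2 x.
rewrite /tilde_trig /tildeF even_halfK// (negbTE ei) in E.
by split; [exact: (E true)|exact: (E false)].
Qed.
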